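(* Let $\Sigma$ be a signature and $\mathcal{R}$ a term rewriting system over $\Sigma$. For all terms $s,t \in T$: $s \twoheadrightarrow t$ (derivability by a proof tree without infinite nesting of $\rightharpoondown^{<}$, as in the context) holds if and only if there is a strongly convergent transfinite rewrite sequence from $s$ to $t$, i.e. $s \twoheadrightarrow_{\mathit{ord}} t$. In other words, $\twoheadrightarrow \;=\; \twoheadrightarrow_{\mathit{ord}}$.
   Context: Let $\Sigma$ be a signature, $\mathcal{X}$ an infinite set of variables, and $T$ the set of finite and infinite terms over $\Sigma$ and $\mathcal{X}$ (possibly infinite labeled trees). Positions of a term are finite words over positive integers; $t|_p$ is the subterm at position $p$. The metric $d$ on $T$: $d(t,t)=0$, and $d(s,t)=2^{-n}$ if $n$ is the least depth at which $s$ and $t$ differ. A term rewriting system $\mathcal{R}$ is a set of pairs $\ell \to r$ of (possibly infinite) terms with $\ell$ not a variable and every variable of $r$ occurring in $\ell$. A rewrite step at position $p$ is $C[\ell\sigma] \to_p C[r\sigma]$ where $C$ is a context (term with exactly one hole) with the hole at position $p$, $\ell\to r\in\mathcal{R}$, $\sigma$ a substitution. Root steps: $\to_{\varepsilon}$ are steps at the empty position. Standard notion: a transfinite rewrite sequence of ordinal length $\alpha$ is a sequence of steps $(t_\beta \to_{p_\beta} t_{\beta+1})_{\beta<\alpha}$ such that for every limit ordinal $\lambda<\alpha$, as $\beta$ approaches $\lambda$ from below, (i) $d(t_\beta, t_\lambda) \to 0$ and (ii) the length $|p_\beta|$ tends to infinity. It is strongly convergent if $\alpha$ is a successor ordinal,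 or there is a term $t_\alpha$ such that (i) and (ii) hold for every limit ordinal $\lambda \le \alpha$; then we write $t_0 \twoheadrightarrow_{\mathit{ord}} t_\alpha$ (length $0$ gives $t_0 \twoheadrightarrow_{\mathit{ord}} t_0$). Coinductive notion: judgements $s \twoheadrightarrow t$, $s \rightharpoondown t$, $s \rightharpoondown^{<} t$; proof trees are finite or infinite (not necessarily well-founded) trees built from the coinductive rules: (split) a node $s \twoheadrightarrow t$ has as premises a finite sequence $s = u_0, \ldots, u_k$ with each consecutive pair either a root step $u_i \to_{\varepsilon} u_{i+1}$ (a leaf) or a node $u_i \rightharpoondown^{<} u_{i+1}$, followed by a node $u_k \rightharpoondown t$; (lift) a node $f(s_1,\ldots,s_n) \rightharpoondown f(t_1,\ldots,t_n)$ or $f(s_1,\ldots,s_n) \rightharpoondown^{<} f(t_1,\ldots,t_n)$ has premises $s_i \twoheadrightarrow t_i$ for $i=1,\ldots,n$; (id) $s \rightharpoondown s$ and $s \rightharpoondown^{<} s$ are axioms. $s \twoheadrightarrow t$ holds iff there is such a proof tree deriving $s \twoheadrightarrow t$ in which no ascending path meets infinitely many $\rightharpoondown^{<}$-nodes. *)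

(* Defs.v *)
From mathcomp Require Import all_boot all_order all_algebra.
From mathcomp Require Import boolp classical_sets cardinality filter wochoice.
From mathcomp Require Import reals topology normedtype.

Set Implicit Arguments.
Unset Strict Implicit.
Unset Printing Implicit Defensive.

Import Order.TTheory GRing.Theory Num.Theory.
Import numFieldNormedType.Exports.

Local Open Scope classical_set_scope.

Record signature := Signature { symbol :> Type; arity : symbol -> nat }.

Section Terms.
Variable F : signature.

(* A finite or infinite term is a labelled tree, given by its partial labelling
   function on positions ([None] outside the domain). The children of a node
   labelled [f] are numbered [1, ..., arity f], so a node with label [f] at [p]
   has exactly the child positions [p.1, ..., p.(arity f)], and variables are
   leaves. No two distinct terms have the same labelling function, so Leibniz
   equality is equality of infinite trees. *)
Definition labelling (X : Type) := seq nat -> option (F + X).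

Definition wf_labelling X (t : labelling X) :=
  t [::] <> None /\
  forall p i, t (rcons p i) <> None <->
              exists2 f : F, t p = Some (inl f) & 0 < i <= arity f.

Record term X := Term {
  label :> seq nat -> option (F + X);
  labelP : wf_labelling label }.

Lemma term_ext X (s t : term X) : label s =1 label t -> s = t.
Proof.
case: s t => [s Ps] [t Pt] /= /funext est; subst t.
by congr Term; exact: Prop_irrelevance.
Qed.

Lemma wf_var X (x : X) :
  wf_labelling (fun p => if p is [::] then Some (inr x) else None).
Proof. by split=> // -[|j p] i; split=> // -[f]. Qed.

Definition var X (x : X) : term X := Term (wf_var x).

Definition app_label X (f : F) (ts : 'I_(arity f) -> term X) : labelling X :=
  fun p => match p with
           | [::] => Some (inl f)
           | 0 :: _ => None
           | i.+1 :: q => if insub i is Some j then ts j q else None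
           end.

Lemma wf_app X f (ts : 'I_(arity f) -> term X) : wf_labelling (app_label ts).
Proof.
split=> // -[|[|j] p] i /=.
- case: i => [|i] /=; first by split=> // -[].
  case: insubP => [j lt_i _|/negP ge_i].
    by split=> [_|_]; [exists f | case: (labelP (ts j))].
  by split=> // -[_ [<-]].
- by split=> // -[].
- case: insubP => [k _ _|_]; first by case: (labelP (ts k)).
  by split=> // -[].
Qed.

Definition app X f (ts : 'I_(arity f) -> term X) : term X := Term (wf_app ts).

(* Follows the position into [t]; on reaching a variable [x] it continues with
   the remaining position inside [sigma x]. *)
Fixpoint subst_label X Y (sigma : X -> term Y) (t : labelling X) (p : seq nat)
    {struct p} : option (F + Y) :=
  match t [::] with
  | Some (inr x) => sigma x p
  | Some (inl f) =>
      if p is i :: q then subst_label sigma (fun r => t (i :: r)) q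
      else Some (inl f)
  | None => None
  end.

Lemma subst_label0 X Y (sigma : X -> term Y) t p :
  t [::] = None -> subst_label sigma t p = None.
Proof. by case: p => [|i p] /= ->. Qed.

Lemma wf_child X (t : labelling X) i :
  wf_labelling t -> t [:: i] <> None -> wf_labelling (fun r => t (i :: r)).
Proof. by case=> _ wt ti; split=> // p j; exact: (wt (i :: p) j). Qed.

Lemma wf_subst X Y (sigma : X -> term Y) (t : labelling X) :
  wf_labelling t -> wf_labelling (subst_label sigma t).
Proof.
move=> wt; split.
  case: wt => + _ /=; case: (t [::]) => [[f|x]|//] // _.
  by case: (labelP (sigma x)).
move=> p i; elim: p t wt => [|j p IHp] t wt /=; case: (wt) => t0 wti.
  case E0: (t [::]) => [[f|x]|]; last by rewrite E0 in t0.
    have {wti} := wti [::] i; rewrite /= E0 => wti.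
    split.
      case Ei: (t [:: i]) => [a|//] _.
      by have [|g [<-] ?] := wti.1 _; rewrite ?Ei //; exists f.
    case=> g [<-] lei; have ti := wti.2 (ex_intro2 _ _ f erefl lei).
    case Ei: (t [:: i]) ti => [[g'|y]|//] _ //.
    by case: (labelP (sigma y)).
  by case: (labelP (sigma x)) => _ /(_ [::] i).
case E0: (t [::]) => [[f|x]|]; last by rewrite E0 in t0.
  case Ej: (t [:: j]) => [a|].
    by apply: IHp; apply: wf_child => //; rewrite Ej.
  by rewrite !subst_label0 //; split=> // -[].
by case: (labelP (sigma x)) => _ /(_ (j :: p) i).
Qed.

Definition subst X Y (sigma : X -> term Y) (t : term X) : term Y :=
  Term (wf_subst sigma (labelP t)).

(* A context is a term over the variables extended with a hole, [None]. *)
Definition hole_at X (C : term (option X)) (p : seq nat) :=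
  forall q, C q = Some (inr None) <-> q = p.

Definition fill X (C : term (option X)) (u : term X) : term X :=
  subst (fun o => if o is Some x then var x else u) C.

Definition occurs X (x : X) (t : term X) := exists p, t p = Some (inr x).

Record trs X := Trs {
  rules : set (term X * term X);
  lhs_nonvar : forall l r, rules (l, r) -> forall x, l <> var x;
  rhs_vars : forall l r, rules (l, r) -> forall x, occurs x r -> occurs x l }.

Definition differ_at X (s t : term X) (n : nat) :=
  exists2 p : seq nat, size p = n & s p <> t p.

Lemma neq_differ X (s t : term X) :
  s <> t -> exists n, (fun n => `[< differ_at s t n >]) n.
Proof.
move=> nst; apply: contra_notP nst => same; apply: term_ext => p.
by apply: contra_notP same => np; exists (size p); apply/asboolP; exists p.
Qed.

Definition dist (R : realType) X (s t : term X) : R :=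
  match pselect (s = t) with
  | left _ => 0%R
  | right neq => (2%:R ^- ex_minn (neq_differ neq))%R
  end.

End Terms.

(* Ordinals are represented by well-ordered types: the elements of a woset of
   order type alpha stand for the ordinals below alpha. *)
Record woset := Woset { elt :> Type; wole : rel elt; woleP : well_order wole }.
Arguments wole {w}.

Definition wolt (W : woset) (a b : W) : bool := ~~ wole b a.

Lemma wole_total (W : woset) : total (@wole W).
Proof.
move=> a b; have [|c [[+ cmin] _]] := @woleP W (fun z => `[< z = a \/ z = b >]).
  by exists a; apply/asboolP; left.
have ca : wole c a by apply: cmin; apply/asboolP; left.
have cb : wole c b by apply: cmin; apply/asboolP; right.
by move/asboolP=> [] ?; subst c; rewrite ?ca ?cb ?orbT.
Qed.

Lemma wole_refl (W : woset) : reflexive (@wole W).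
Proof. by move=> a; have := wole_total a a; rewrite orbb. Qed.

Lemma wole_anti (W : woset) : antisymmetric (@wole W).
Proof.
move=> a b /andP[ab ba].
have [|c [_ cuniq]] := @woleP W (fun z => `[< z = a \/ z = b >]).
  by exists a; apply/asboolP; left.
have minE d : d = a \/ d = b -> wole d a && wole d b -> c = d.
  move=> dE /andP[da db]; apply: cuniq; split; first exact/asboolP.
  by move=> _ /asboolP[]->.
transitivity c; first by apply/esym/minE; [left | rewrite wole_refl].
by apply: minE; [right | rewrite wole_refl ba].
Qed.

Definition le_top (W : woset) : rel (option W) :=
  fun x y => match x, y with
             | _, None => true
             | None, Some _ => false
             | Some a, Some b => wole a b
             end.

Lemma le_top_wo (W : woset) : well_order (@le_top W).
Proof.
apply: antisymmetric_well_order.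
  by move=> [a|] [b|] //= /wole_anti ->.
move=> A [x Ax].
have [[a Aa]|noA] := pselect (exists a : W, Some a \in A).
  have [|c [[Ac cmin] _]] := @woleP W (fun a => Some a \in A); first by exists a.
  by exists (Some c); split=> // -[b Ab|//]; exact: cmin.
exists x; split=> // -[b Ab|_]; first by case: noA; exists b.
by case: x Ax.
Qed.

(* The ordinal alpha + 1: its elements [Some b] are the ordinals below alpha and
   [None] is alpha itself. *)
Definition wosucc (W : woset) : woset := Woset (@le_top_wo W).

Section Ordinals.
Variable W : woset.
Implicit Types a b c : W.

Definition is_succ b c := wolt b c /\ forall d, wolt b d -> wole c d.
Definition is_zero c := forall b, wole c b.
Definition is_limit c := ~ is_zero c /\ ~ exists b, is_succ b c.

End Ordinals.

(* The filter on the ordinals below alpha that approaches [l <= alpha] strictly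
   from below. *)
Definition below (W : woset) (l : wosucc W) : set_system W :=
  filter_from [set b : W | wolt (Some b : wosucc W) l]
    (fun b => [set c : W | wole b c /\ wolt (Some c : wosucc W) l]).

Section Rewriting.
Variables (F : signature) (X : Type) (RS : trs F X).
Implicit Types s t u : term F X.

Definition step (p : seq nat) s t :=
  exists (C : term F (option X)) l r (sigma : X -> term F X),
    [/\ hole_at C p, rules RS (l, r), s = fill C (subst sigma l)
      & t = fill C (subst sigma r)].

(* [ts] assigns a term to every ordinal up to alpha included, [ps] a position to
   every ordinal below alpha. *)
Definition converges_at (R : realType) (W : woset)
    (ts : wosucc W -> term F X) (ps : W -> seq nat) (l : wosucc W) :=
  (dist R (ts (Some b)) (ts l) @[b --> below l] --> 0%R) /\
  (size (ps b) @[b --> below l] --> \oo).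

(* When alpha is a limit, the last term [ts None] is not part of the rewrite
   sequence: nothing is required of it here. *)
Definition is_rewrite_seq (R : realType) (W : woset)
    (ts : wosucc W -> term F X) (ps : W -> seq nat) :=
  (forall (b : W) (c : wosucc W),
     is_succ (Some b : wosucc W) c -> step (ps b) (ts (Some b)) (ts c)) /\
  (forall l : W, is_limit (Some l : wosucc W) -> converges_at R ts ps (Some l)).

Definition strongly_convergent (R : realType) (W : woset)
    (ts : wosucc W -> term F X) (ps : W -> seq nat) :=
  (exists b, is_succ b (None : wosucc W)) \/
  (forall l : wosucc W, is_limit l -> converges_at R ts ps l).

Definition rewrites_ord (R : realType) (s t : term F X) :=
  exists (W : woset) (ts : wosucc W -> term F X) (ps : W -> seq nat),
    [/\ is_rewrite_seq R ts ps, strongly_convergent R ts ps,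
        exists2 z : wosucc W, is_zero z & ts z = s
      & ts None = t].

Inductive judgement :=
  | Root of term F X & term F X    (* [s ->_eps t] *)
  | Many of term F X & term F X    (* [s ->> t] *)
  | Down of term F X & term F X    (* [s -^ t], the half arrow *)
  | DownLt of term F X & term F X. (* [s -^< t], the marked half arrow *)

(* [split_prefix s js u]: [js] are the judgements between the consecutive terms
   of a finite sequence from [s] to [u]. *)
Inductive split_prefix : term F X -> seq judgement -> term F X -> Prop :=
  | split_nil s : split_prefix s [::] s
  | split_root s u v js :
      split_prefix u js v -> split_prefix s (Root s u :: js) v
  | split_down s u v js :
      split_prefix u js v -> split_prefix s (DownLt s u :: js) v.

Definition lift_premises (f : F) (ss ts : 'I_(arity f) -> term F X) :=
  [seq Many (ss i) (ts i) | i <- enum 'I_(arity f)].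

(* [rule js j]: [j] follows from the list of premises [js] by one rule. *)
Inductive rule : seq judgement -> judgement -> Prop :=
  | rule_root s t : step [::] s t -> rule [::] (Root s t)
  | rule_split s js u t :
      split_prefix s js u -> rule (rcons js (Down u t)) (Many s t)
  | rule_lift f (ss ts : 'I_(arity f) -> term F X) :
      rule (lift_premises ss ts) (Down (app ss) (app ts))
  | rule_lift_lt f (ss ts : 'I_(arity f) -> term F X) :
      rule (lift_premises ss ts) (DownLt (app ss) (app ts))
  | rule_id s : rule [::] (Down s s)
  | rule_id_lt s : rule [::] (DownLt s s).

CoInductive tree := Node (j : judgement) (n : nat) (prems : 'I_n -> tree).

Definition concl (T : tree) := let: Node j _ _ := T in j.
Definition nprems (T : tree) := let: Node _ n _ := T in n.
Definition prem (T : tree) : 'I_(nprems T) -> tree :=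
  let: Node _ _ f := T in f.

Inductive node_of (T : tree) : tree -> Prop :=
  | node_root : node_of T T
  | node_prem N (i : 'I_(nprems N)) : node_of T N -> node_of T (prem i).

Definition proof_tree (T : tree) :=
  forall N, node_of T N ->
    rule [seq concl (prem i) | i <- enum 'I_(nprems N)] (concl N).

Definition infinite_path (T : tree) (path : nat -> tree) :=
  path 0 = T /\ forall n, exists i, path n.+1 = @prem (path n) i.

Definition is_DownLt (j : judgement) := if j is DownLt _ _ then true else false.

(* Finite paths cannot meet infinitely many nodes, so only infinite ones matter. *)
Definition infinitely_nested (T : tree) :=
  exists2 path, infinite_path T path &
    forall m, exists2 n, m <= n & is_DownLt (concl (path n)).

Definition rewrites_coind (s t : term F X) :=
  exists T : tree, [/\ concl T = Many s t, proof_tree T & ~ infinitely_nested T].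

End Rewriting.

(* Main.v *)
(* From a strongly convergent sequence to a proof tree: every node is read off a
   position [p] and an interval [a, b] of the given sequence in which no step
   lies strictly above [p]. The steps at [p] itself are finitely many, as depths
   tend to infinity at limit ordinals, and cut the interval into the premises of
   a split. The right end of the interval never increases along a path and
   strictly decreases at the marked nodes, so these cannot nest infinitely.

   From a proof tree to a sequence: by well-founded induction on the nesting of
   marked nodes, the finite prefixes of all splits are already realised. A node
   [s ->> t] first performs its own prefix, then those of its premises one level
   deeper, and so on; these [omega] stages act at increasing depth, and their
   concatenation converges strongly to [t]. *)

Require Import Defs.
From mathcomp Require Import all_boot all_order all_algebra.
From mathcomp Require Import boolp classical_sets cardinality filter wochoice.
From mathcomp Require Import reals topology normedtype.
From Stdlib Require List.

Set Implicit Arguments.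
Unset Strict Implicit.
Unset Printing Implicit Defensive.

Import Order.TTheory GRing.Theory Num.Theory.
Import numFieldNormedType.Exports.

(** * Well-ordered types and terms *)

Lemma In_cat (T : Type) (x : T) (l l' : seq T) :
  List.In x (l ++ l') <-> List.In x l \/ List.In x l'.
Proof.
by elim: l => [|y l IHl] /=; [split=> [|[]//]; right | rewrite IHl or_assoc].
Qed.

Lemma In_tnth (T : Type) (l : seq T) (i : 'I_(size l)) : List.In (tnth (in_tuple l) i) l.
Proof.
move: i; case: l => [[]//|x l] i; rewrite (tnth_nth x).
elim: (x :: l) (nat_of_ord i) (ltn_ord i) => [|y s IHs] [|k] //= ks; first by left.
by right; apply: IHs.
Qed.

Lemma In_map (T U : Type) (g : T -> U) (l : seq T) y :
  List.In y (map g l) -> exists x, y = g x.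
Proof. by elim: l => //= x l IHl [<-|/IHl //]; exists x. Qed.

Lemma well_order_build (T : Type) (le : rel T) :
  antisymmetric le ->
  (forall P : T -> Prop, (exists x, P x) ->
     exists2 m, P m & forall y, P y -> le m y) ->
  well_order le.
Proof.
move=> anti mn; apply: antisymmetric_well_order => // A [x Ax].
have [m Am minm] := mn (fun y => y \in A) (ex_intro _ x Ax).
by exists m; split=> // y /minm.
Qed.

Section WosetTheory.
Variable W : woset.
Implicit Types (a b c : W) (P : W -> Prop).

Lemma wo_min P : (exists x, P x) -> exists2 m, P m & forall y, P y -> wole m y.
Proof.
case=> x Px; have [|m [[/asboolP Pm minm] _]] := @woleP W (fun z => `[< P z >]).
  by exists x; apply/asboolP.
by exists m => // y Py; apply: minm; apply/asboolP.
Qed.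

(** [well_order] speaks only of minima of non-empty sets, so transitivity is read off the minimum of
    the three points. *)
Lemma wole_trans a b c : wole a b -> wole b c -> wole a c.
Proof.
move=> ab bc.
have [|m mE minm] := @wo_min (fun z => [\/ z = a, z = b | z = c]).
  by exists a; constructor 1.
have ma := minm a (Or31 _ _ erefl); have mb := minm b (Or32 _ _ erefl).
have mc := minm c (Or33 _ _ erefl).
case: mE => mE; subst m => //.
  by have -> : a = b by apply: wole_anti; rewrite ab ma.
by have <- : b = c by apply: wole_anti; rewrite bc mb.
Qed.

Lemma woltNge a b : wolt a b = ~~ wole b a. Proof. by []. Qed.

Lemma woleNgt a b : wole a b = ~~ wolt b a. Proof. by rewrite negbK. Qed.

Lemma wolt_irr a : ~ wolt a a. Proof. by rewrite /wolt wole_refl. Qed.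

Lemma woltW a b : wolt a b -> wole a b.
Proof. by rewrite /wolt => ba; have := wole_total a b; rewrite (negbTE ba) orbF. Qed.

Lemma wole_lt_trans a b c : wole a b -> wolt b c -> wolt a c.
Proof. by rewrite /wolt => ab; apply: contra => ca; apply: wole_trans ab. Qed.

Lemma wolt_le_trans a b c : wolt a b -> wole b c -> wolt a c.
Proof. by rewrite /wolt => + bc; apply: contra => ca; apply: wole_trans ca. Qed.

Lemma wole_eqVlt a b : wole a b -> a = b \/ wolt a b.
Proof.
move=> ab; rewrite /wolt; case ba: (wole b a); last by right.
by left; apply: wole_anti; rewrite ab.
Qed.

Lemma wo_ind P : (forall a, (forall b, wolt b a -> P b) -> P a) -> forall a, P a.
Proof.
move=> IH a; apply: contrapT => nPa.
have [m nPm minm] := @wo_min (fun z => ~ P z) (ex_intro _ a nPa).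
apply: nPm; apply: IH => b bm; apply: contrapT => /minm.
by rewrite woleNgt bm.
Qed.

Lemma wo_max a b : exists c, [/\ wole a c, wole b c & c = a \/ c = b].
Proof.
by case/orP: (wole_total a b) => h; [exists b | exists a];
  rewrite h wole_refl; split=> //; [right | left].
Qed.

Lemma is_succ_lt b c d : is_succ b c -> wolt d c -> wole d b.
Proof.
by case=> _ bmin; rewrite [wole d b]woleNgt; apply: contraTN => /bmin; rewrite woleNgt.
Qed.

Lemma wosucc_leE a b : wole (Some a : wosucc W) (Some b) = wole a b.
Proof. by []. Qed.

Lemma wosucc_ltE a b : wolt (Some a : wosucc W) (Some b) = wolt a b.
Proof. by []. Qed.

Lemma wosucc_top (l : wosucc W) : wole l None.
Proof. by case: l. Qed.

Lemma wo_cases a : [\/ is_zero a, exists b, is_succ b a | is_limit a].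
Proof.
have [z|nz] := pselect (is_zero a); first by constructor 1.
have [s|ns] := pselect (exists b, is_succ b a); first by constructor 2.
by constructor 3.
Qed.

End WosetTheory.

(** * Ordinal sums and suborders *)

Section SumWoset.
Variable V : nat -> woset.

(** Lexicographic order: the ordinal sum of the [V n], taken in order type omega. *)
Definition sum_le (x y : {n : nat & V n}) : bool :=
  (tag x < tag y) || ((tag x == tag y) && wole (tagged x) (tagged_as x y)).

Lemma sum_leP : well_order sum_le.
Proof.
apply: well_order_build => [[n a] [m b]|P [[n0 a0] P0]].
  rewrite /sum_le /=; case: ltngtP => //= nm; subst m.
  by rewrite !tagged_asE => /wole_anti ->.
have /ex_minnP[n /asboolP[a Pa] minn] : exists n, `[< exists a : V n, P (Tagged V a) >].
  by exists n0; apply/asboolP; exists a0.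
have [m Pm minm] := @wo_min (V n) (fun a => P (Tagged V a)) (ex_intro _ a Pa).
exists (Tagged V m) => // -[k b] Pb; rewrite /sum_le /=.
have : n <= k by apply: minn; apply/asboolP; exists b.
rewrite leq_eqVlt => /orP[/eqP nk|-> //]; subst k.
by rewrite tagged_asE eqxx /= minm ?orbT.
Qed.

Definition wosum : woset := Woset sum_leP.

Lemma wosum_leE n (a b : V n) : wole (Tagged V a : wosum) (Tagged V b) = wole a b.
Proof. by rewrite {1}/wole /= /sum_le /= ltnn eqxx tagged_asE. Qed.

Lemma wosum_ltE n (a b : V n) : wolt (Tagged V a : wosum) (Tagged V b) = wolt a b.
Proof. by rewrite /wolt wosum_leE. Qed.

Lemma wosum_lt n m (a : V n) (b : V m) : n < m -> wolt (Tagged V a : wosum) (Tagged V b).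
Proof.
by move=> nm; rewrite /wolt {1}/wole /= /sum_le /= ltnNge ltnW //= gtn_eqF.
Qed.

Lemma wosum_lt_le n m (a : V n) (b : V m) :
  n < m -> wole (Tagged V a : wosum) (Tagged V b).
Proof. by move=> nm; apply: woltW; apply: wosum_lt. Qed.

Lemma wosum_le_tag (x y : wosum) : wole x y -> tag x <= tag y.
Proof.
rewrite {1}/wole /= /sum_le => /orP[/ltnW //|/andP[/eqP xy _]].
by rewrite leq_eqVlt xy eqxx.
Qed.

End SumWoset.

Section SubWoset.
Variables (W : woset) (Q : pred W).

Lemma sub_leP : well_order (fun x y : {a : W | Q a} => wole (sval x) (sval y)).
Proof.
apply: well_order_build => [[a Qa] [b Qb] /= /wole_anti ab|P [[a Qa] Pa]].
  by subst b; congr exist; exact: bool_irrelevance.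
have [|m [Qm Pm] minm] := @wo_min W (fun a => exists Qa : Q a, P (exist _ a Qa)).
  by exists a, Qa.
by exists (exist _ m Qm) => // -[b Qb] Pb; apply: minm; exists Qb.
Qed.

Definition wosub : woset := Woset sub_leP.

End SubWoset.

Lemma unit_leP : well_order (fun _ _ : unit => true).
Proof. by apply: well_order_build => [[] []|P [[] Pt]] //; exists tt. Qed.

Definition wounit : woset := Woset unit_leP.

(** * Labels, subterms and agreement up to a depth *)

Section TermTheory.
Variable F : signature.

Section OneSet.
Variable X : Type.
Implicit Types (s t u : term F X) (p q : seq nat).

Lemma label_cat (t : labelling F X) p q :
  wf_labelling t -> q <> [::] -> t (p ++ q) <> None ->
  exists f : F, t p = Some (inl f).
Proof.
case=> _ wt; elim/last_ind: q => // q i IHq _; rewrite -rcons_cat => /wt[f E _].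
have [E0|nE] := pselect (q = [::]); first by exists f; rewrite -E E0 cats0.
by apply: IHq => //; rewrite E.
Qed.

Lemma label_cat_None (t : labelling F X) p q :
  wf_labelling t -> t p = None -> t (p ++ q) = None.
Proof.
move=> wt tp; case: q => [|i q]; first by rewrite cats0.
apply: contrapT => /(label_cat (p := p) (q := i :: q) wt)[] // f.
by rewrite tp.
Qed.

(** Stands for a distance of at most 2^-n, so that rewriting can be studied without real numbers. *)
Definition agree n s t := forall p, size p < n -> s p = t p.

Lemma agree_sym n s t : agree n s t -> agree n t s.
Proof. by move=> st p /st. Qed.

Lemma agree_trans n s t u : agree n s t -> agree n t u -> agree n s u.
Proof. by move=> st tu p np; rewrite st // tu. Qed.

Lemma agreeW m n s t : m <= n -> agree n s t -> agree m s t.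
Proof. by move=> mn st p pm; apply: st; apply: leq_trans mn. Qed.

Lemma agree_eq s t : (forall n, agree n s t) -> s = t.
Proof. by move=> st; apply: term_ext => p; apply: (st (size p).+1). Qed.

Lemma wf_subterm t p : t p <> None -> wf_labelling (fun q => t (p ++ q)).
Proof.
move=> tp; split=> [|q i]; first by rewrite cats0.
by rewrite -rcons_cat; apply: (labelP t).2.
Qed.

(* Junk value: [t] itself when [p] is not a position of [t]. *)
Definition subterm t p : term F X :=
  if pselect (t p <> None) is left tp then Term (wf_subterm tp) else t.

Lemma subtermE t p q : t p <> None -> subterm t p q = t (p ++ q).
Proof. by move=> tp; rewrite /subterm; case: pselect. Qed.

Lemma subterm_nil t : subterm t [::] = t.
Proof. by apply: term_ext => p; rewrite subtermE //; case: (labelP t). Qed.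

Lemma subterm_cat t p q :
  t (p ++ q) <> None -> subterm (subterm t p) q = subterm t (p ++ q).
Proof.
move=> tpq; have tp : t p <> None by move/(label_cat_None q (labelP t)).
by apply: term_ext => r; rewrite !subtermE ?catA // subtermE.
Qed.

Lemma head_var t x : t [::] = Some (inr x) -> t = var F x.
Proof.
move=> t0; apply: term_ext => -[//|i p] /=.
apply: contrapT => /(@label_cat t [::] (i :: p) (labelP t))[] // f.
by rewrite t0.
Qed.

Lemma head_app t f : t [::] = Some (inl f) ->
  (forall i : 'I_(arity f), t [:: i.+1] <> None) /\
  t = app (fun i : 'I_(arity f) => subterm t [:: i.+1]).
Proof.
move=> t0.
have ti (i : 'I_(arity f)) : t [:: i.+1] <> None.
  by apply/((labelP t).2 [::] i.+1).2; exists f => //=.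
split=> //; apply: term_ext => -[//|[|i] p] /=.
  apply: contrapT => tp.
  have : t [:: 0] <> None by move/(label_cat_None p (labelP t)).
  by case/((labelP t).2 [::] 0).1.
case: insubP => [j _ <-|/negP ige]; first by rewrite subtermE.
apply: contrapT => tp.
have : t [:: i.+1] <> None by move/(label_cat_None p (labelP t)).
by case/((labelP t).2 [::] i.+1).1 => g; rewrite t0 => -[<-].
Qed.

Lemma agree_app n f (ss ts : 'I_(arity f) -> term F X) :
  (forall i, agree n (ss i) (ts i)) -> agree n.+1 (app ss) (app ts).
Proof. by move=> st [//|[|i] p] //= pn; case: insub => // j; apply: st. Qed.

End OneSet.

(** Evaluation at [q] consults only variables at prefixes of [q]; this isolates the part of a
    context away from its hole. *)
Lemma subst_label_congr X Y (sg sg' : X -> term F Y) (t : labelling F X) q :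
  (forall q0 x, prefix q0 q -> t q0 = Some (inr x) -> sg x = sg' x) ->
  subst_label sg t q = subst_label sg' t q.
Proof.
elim: q t => [|i q IHq] t H /=; case E: (t [::]) => [[f|x]|] //;
  try by rewrite (H _ _ _ E).
by apply: IHq => q0 x q0q; apply: H; rewrite prefix_cons eqxx.
Qed.

Lemma subst_label_var X Y (sg : X -> term F Y) (t : labelling F X) p q x :
  wf_labelling t -> t p = Some (inr x) -> subst_label sg t (p ++ q) = sg x q.
Proof.
elim: p t => [|i p IHp] t wt tx.
  by case: q => [|j q] /=; rewrite tx.
have [] // := @label_cat X t [::] (i :: p) wt; first by rewrite tx.
move=> f E; rewrite /= E; apply: IHp => //; apply: wf_child => //.
by move=> ti; have := label_cat_None p wt ti; rewrite /= tx.
Qed.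

End TermTheory.

Definition upd (I : eqType) (T : Type) (ss : I -> T) (i : I) (s : T) : I -> T :=
  fun j => if j == i then s else ss j.

(** * Contexts and single steps *)

Section FillTheory.
Variables (F : signature) (X : Type).
Implicit Types (s t u : term F X) (C : term F (option X)) (p q : seq nat).

Lemma fill_at C u p q : hole_at C p -> fill C u (p ++ q) = u q.
Proof.
move=> Cp; rewrite /fill /= (@subst_label_var _ _ _ _ _ p q None (labelP C)) //.
exact/Cp.
Qed.

Lemma fill_out C u u' p q :
  hole_at C p -> ~~ prefix p q -> fill C u q = fill C u' q.
Proof.
move=> Cp pq; apply: subst_label_congr => q0 [x|] // q0q /Cp q0p.
by rewrite -q0p q0q in pq.
Qed.

Lemma fill_hole u : fill (var F None) u = u.
Proof. by apply: term_ext => -[]. Qed.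

(** A context without hole, used for the arguments beside the one that contains the hole. *)
Definition lift_term t : term F (option X) := subst (fun x => var F (Some x)) t.

Lemma lift_term_nohole t q : lift_term t q <> Some (inr None).
Proof.
rewrite /lift_term /=; elim: q (label t) => [|i q IHq] l /=;
  case: (l [::]) => [[f|x]|] //.
Qed.

Lemma fill_lift_term t u : fill (lift_term t) u = t.
Proof.
apply: term_ext => p; rewrite /fill /lift_term /=.
elim: p (label t) (labelP t) => [|i p IHp] l wl.
  by rewrite /=; case E: (l [::]) => [[f|x]|].
have [l0 _] := wl; rewrite /=; case E: (l [::]) l0 => [[f|x]|] // _.
  case Ei: (l [:: i]) => [a|].
    by apply: IHp; apply: wf_child => //; rewrite Ei.
  have := label_cat_None p wl Ei => /= ->.
  by apply: subst_label0; rewrite subst_label0.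
by have /(congr1 (fun t => label t (i :: p)))/= <- := @head_var _ _ (Term wl) x E.
Qed.

Lemma fill_app f (Cs : 'I_(arity f) -> term F (option X)) u :
  fill (app Cs) u = app (fun i => fill (Cs i) u).
Proof.
apply: term_ext => -[//|[|i] p]; first by rewrite /= subst_label0.
by rewrite /=; case: insubP => //= _; rewrite subst_label0.
Qed.

Variable RS : trs F X.

Lemma step_out p s t q : step RS p s t -> ~~ prefix p q -> s q = t q.
Proof. by case=> C [l] [r] [sg] [Cp _ -> ->]; apply: fill_out. Qed.

Lemma step_agree p s t n : step RS p s t -> n <= size p -> agree n s t.
Proof.
move=> st np q qn; apply: step_out st _; apply/negP => /size_prefix.
by rewrite leqNgt (leq_trans qn).
Qed.

Lemma step_subterm p s t :
  step RS p s t -> step RS [::] (subterm s p) (subterm t p).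
Proof.
case=> C [l] [r] [sg] [Cp lr -> ->].
have fE u : subterm (fill C u) p = u.
  apply: term_ext => q; rewrite subtermE ?fill_at //.
  by rewrite -[p]cats0 fill_at //; case: (labelP u).
rewrite !fE; exists (var F None), l, r, sg; split; rewrite ?fill_hole //.
by move=> [|i q] /=; split.
Qed.

Lemma step_app p (f : F) (ss : 'I_(arity f) -> term F X) (i : 'I_(arity f)) s t :
  step RS p s t -> step RS (i.+1 :: p) (app (upd ss i s)) (app (upd ss i t)).
Proof.
case=> C [l] [r] [sg] [Cp lr -> ->].
exists (app (fun j => if j == i then C else lift_term (ss j))), l, r, sg.
have fE u : app (upd ss i (fill C u)) =
            fill (app (fun j => if j == i then C else lift_term (ss j))) u.
  rewrite fill_app; congr app; apply: funext => j; rewrite /upd.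
  by case: eqP => // _; rewrite fill_lift_term.
split=> // -[|[|k] q] /=; try by split.
case: insubP => [j _ jk|].
  case: eqP => [ji|nji].
    split=> [/Cp ->|[_ ->]]; first by rewrite -jk ji.
    by apply/Cp.
  split=> [/lift_term_nohole //|[ki _]].
  by case: nji; apply: val_inj; rewrite jk.
by move=> /negP ki; split=> // -[kE _]; case: ki; rewrite kE.
Qed.

End FillTheory.

(** * Reductions indexed by their target points *)

Section Reductions.
Variables (F : signature) (X : Type) (RS : trs F X).
Implicit Types (s t u : term F X) (p q : seq nat).

(* A rewrite sequence whose points carry the step that leads to them rather than
   the step that leaves them. [ps a = None] marks limits and idle moves alike:
   for an idle move into [a], the witness [b] is the predecessor of [a]. *)
Definition arrival (A : woset) (ts : A -> term F X) (ps : A -> option (seq nat))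
    (a : A) :=
  match ps a with
  | Some p => exists2 b, is_succ b a & step RS p (ts b) (ts a)
  | None => forall n, exists2 b, wolt b a & forall c, wole b c -> wolt c a ->
      agree n (ts c) (ts a) /\
      (wolt b c -> forall p, ps c = Some p -> n <= size p)
  end.

(** Both ends are points of the order. The lower bound [d] on the depth of steps is what lets
    infinitely many reductions be concatenated. *)
Record reduction (d : nat) (s t : term F X) := Reduction {
  pts : woset;
  at_ : pts -> term F X;
  pos : pts -> option (seq nat);
  bot : pts;
  top : pts;
  bot_le : forall a, wole bot a;
  top_ge : forall a, wole a top;
  at_bot : at_ bot = s;
  at_top : at_ top = t;
  pos_bot : pos bot = None;
  pos_arrival : forall a, a <> bot -> arrival at_ pos a;
  pos_deep : forall a p, pos a = Some p -> d <= size p }.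

Definition reduces d s t := inhabited (reduction d s t).

(** Steps at depth [d] or more, and limits taken at precision [d], both preserve the labels above
    depth [d]. *)
Lemma reduction_agree d s t (r : reduction d s t) (a : pts r) :
  agree d s (at_ a).
Proof.
elim/wo_ind: a => a IH; have [->|na] := pselect (a = bot r).
  by rewrite at_bot.
move: (pos_arrival na); rewrite /arrival; case E: (pos a) => [p|].
  case=> b [ba _] st; apply: agree_trans (IH _ ba) _.
  exact: step_agree st (pos_deep E).
move=> /(_ d)[b ba /(_ b (wole_refl b) ba)[bE _]].
exact: agree_trans (IH _ ba) bE.
Qed.

Lemma reduction_idle d s t (r : reduction d s t) (x y : pts r) :
  wole x y -> (forall z, wolt x z -> wole z y -> pos z = None) -> at_ x = at_ y.
Proof.
elim/wo_ind: y => y IH xy idle; have [->//|lt_xy] := wole_eqVlt xy.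
have ny : y <> bot r by move=> yb; move: lt_xy; rewrite woltNge yb bot_le.
apply: agree_eq => n.
move: (pos_arrival ny); rewrite /arrival idle ?wole_refl //.
(* The witness [b] may lie below [x]; the larger of the two lies between [x] and [y] and still
   agrees with [y] up to [n]. *)
move=> /(_ n)[b lt_by H]; have [c [bc xc cE]] := wo_max b x.
have cy : wolt c y by case: cE => ->.
rewrite (IH c) // => [|z xz zc]; first by case: (H c).
by apply: idle => //; apply: wole_trans (woltW cy).
Qed.

Lemma reduces_refl d s : reduces d s s.
Proof.
by constructor; exists wounit (fun=> s) (fun=> None) tt tt => // -[].
Qed.

Lemma reduces_step d p s t : step RS p s t -> d <= size p -> reduces d s t.
Proof.
move=> st dp; constructor.
exists (wosucc wounit) (fun o => if o is Some _ then s else t)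
  (fun o => if o is Some _ then None else Some p) (Some tt) None => //.
- by case=> [[]|].
- by case.
- case=> [[] //|_]; exists (Some tt) => //.
  by split=> // -[[]|].
- by case=> // q [<-].
Qed.

Lemma reducesW d d' s t : d' <= d -> reduces d s t -> reduces d' s t.
Proof.
move=> dd' [[A at' ps b t' ? ? ? ? ? ? deep]]; constructor.
by exists A at' ps b t' => // a p /deep; apply: leq_trans.
Qed.

Lemma reduces_app1 d (f : F) (ss : 'I_(arity f) -> term F X) i s t :
  reduces d s t -> reduces d.+1 (app (upd ss i s)) (app (upd ss i t)).
Proof.
case=> r; constructor.
exists (pts r) (fun a => app (upd ss i (at_ a)))
  (fun a => omap (cons i.+1) (pos a)) (bot r) (top r).
- exact: bot_le.
- exact: top_ge.
- by rewrite at_bot.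
- by rewrite at_top.
- by rewrite pos_bot.
- move=> a /pos_arrival; rewrite /arrival; case: (pos a) => [p|] /=.
    by case=> b ba st; exists b => //; apply: step_app.
  move=> H n; have [b ba {}H] := H n; exists b => // c bc ca.
  have [cE cn] := H c bc ca; split=> [|lt_bc p].
    apply: (agreeW (leqnSn n)); apply: agree_app => j; rewrite /upd.
    by case: eqP.
  case E: (pos c) => [q|] //= [<-]; apply: leq_trans (leqnSn _).
  exact: cn E.
- by move=> a p; case E: (pos a) => [q|] //= [<-]; apply: (pos_deep E).
Qed.

(* Between the last point of a stage and the first of the next nothing happens,
   so the points of all stages, put end to end, need no merging. *)
Lemma reduces_omega d (e : nat -> nat) (ss : nat -> term F X) t :
  (forall n, reduces (e n) (ss n) (ss n.+1)) -> (forall n, d <= e n) ->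
  (forall k, exists N, forall n, N <= n -> k <= e n /\ agree k (ss n) t) ->
  reduces d (ss 0) t.
Proof.
move=> /(_ _)/inhabited_witness r de lim; constructor.
pose A := wosum (fun n => pts (r n)).
pose tg n (a : pts (r n)) : A := Tagged (fun n => pts (r n)) a.
pose mk n a : wosucc A := Some (tg n a).
(* The extra point above all stages is their limit and carries [t]. *)
exists (wosucc A)
  (fun o => if o is Some x then at_ (tagged x) else t)
  (fun o => if o is Some x then pos (tagged x) else None)
  (mk 0 (bot (r 0))) None.
- case=> [[[|n] a]|] //.
    by rewrite wosucc_leE wosum_leE bot_le.
- by case.
- exact: at_bot.
- by [].
- exact: pos_bot.
(* Away from its first point, a stage keeps its own arrivals: predecessors and intervals inside it
   are unchanged in the sum. *)
- have lim_ext n (a : pts (r n)) : a <> bot (r n) ->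
    arrival (fun o : wosucc A => if o is Some x then at_ (tagged x) else t)
      (fun o => if o is Some x then pos (tagged x) else None) (mk n a).
    move=> /pos_arrival; rewrite /arrival /=; case E: (pos a) => [p|].
      case=> b [ba bmin] st; exists (mk n b) => //.
      split; first by rewrite wosucc_ltE wosum_ltE.
      case=> [[m c]|//]; case: (ltngtP n m) => nm.
      + by move=> _; rewrite wosucc_leE; apply: wosum_lt_le.
      + by rewrite woltNge wosucc_leE wosum_lt_le.
      + by subst m; rewrite wosucc_ltE wosum_ltE wosucc_leE wosum_leE; apply: bmin.
    move=> H k; have [b ba {}H] := H k; exists (mk n b).
      by rewrite wosucc_ltE wosum_ltE.
    case=> [[m c]|//] bc ca.
    have {}bc : wole (tg n b) (tg m c) := bc.
    have {}ca : wolt (tg m c) (tg n a) := ca.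
    have nm : n = m.
      by apply/eqP; rewrite eqn_leq (wosum_le_tag bc) (wosum_le_tag (woltW ca)).
    subst m; move: bc ca; rewrite wosum_leE wosum_ltE => bc ca.
    have [cE cn] := H c bc ca; split=> // lt_bc; apply: cn.
    by have : wolt (tg n b) (tg n c) := lt_bc; rewrite wosum_ltE.
  case=> [[n a]|_].
    have [->|na _] := pselect (a = bot (r n)); last exact: lim_ext.
    (* The first point of stage [n.+1] is reached by an idle move from the top of stage [n], which
       carries the same term. *)
    case: n {a} => // n _; rewrite /arrival /= pos_bot => k.
    exists (mk n (top (r n))); first exact: wosum_lt.
    case=> [[m c]|//] bc ca /=.
    have {}bc : wole (tg n (top (r n))) (tg m c) := bc.
    have {}ca : wolt (tg m c) (tg n.+1 (bot (r n.+1))) := ca.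
    have nm := wosum_le_tag bc; have mn := wosum_le_tag (woltW ca).
    move: mn; rewrite leq_eqVlt => /orP[/eqP /= mn|/=].
      by subst m; move: ca; rewrite wosum_ltE woltNge bot_le.
    rewrite ltnS => mn; have {nm mn} nm : n = m by apply/eqP; rewrite eqn_leq nm.
    subst m; move: (bc); rewrite wosum_leE => tc.
    have -> : c = top (r n) by apply: wole_anti; rewrite tc top_ge.
    by rewrite at_top at_bot; split=> // /(@wolt_irr (wosucc A)).
  (* At the final limit, precision [k] is met from stage [N] on: each stage starts close to [t], and
     its steps are too deep to disturb this. *)
  move=> k; have [N HN] := lim k; exists (mk N (bot (r N))) => //.
  case=> [[n a]|//] /wosum_le_tag /= /HN[kn kt] _; split=> [|_ p /pos_deep].
    apply: agree_trans kt; apply: agree_sym; apply: agreeW kn _.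
    exact: reduction_agree.
  exact: leq_trans.
- by case=> [[n a] p /pos_deep|//]; apply: leq_trans.
Qed.

(** An omega-concatenation in which all stages but the first two are empty. *)
Lemma reduces_trans d s t u : reduces d s t -> reduces d t u -> reduces d s u.
Proof.
move=> st tu.
pose v n := if n is n'.+1 then if n' is 0 then t else u else s.
(* Empty stages meet any depth bound, and the bound [d + n] tends to infinity. *)
apply: (@reduces_omega d (fun n => if n < 2 then d else d + n) v).
- by case=> [|[|n]] //; apply: reduces_refl.
- by move=> n; case: ifP => // _; apply: leq_addr.
- move=> k; exists k.+2 => -[|[|n]] // kn; split=> //=.
  by rewrite (leq_trans _ (leq_addl _ _)) // ltnW // ltnW.
Qed.

(** Arities are finite, so the arguments can be reduced one after another; [mix k] has the first [k]
    of them done. *)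
Lemma reduces_app d (f : F) (ss ts : 'I_(arity f) -> term F X) :
  (forall i, reduces d (ss i) (ts i)) -> reduces d.+1 (app ss) (app ts).
Proof.
move=> st; pose mix (k : nat) (i : 'I_(arity f)) := if i < k then ts i else ss i.
have mixE k : k <= arity f -> reduces d.+1 (app ss) (app (mix k)).
  elim: k => [|k IHk] lek; first exact: reduces_refl.
  apply: reduces_trans (IHk (ltnW lek)) _.
  pose i := Ordinal lek.
  have <- : upd (mix k) i (ss i) = mix k.
    by apply: funext => j; rewrite /upd; case: eqP => // ->; rewrite /mix ltnn.
  have <- : upd (mix k) i (ts i) = mix k.+1.
    apply: funext => j; rewrite /upd /mix.
    have [->|nji] := eqVneq j i; first by rewrite ltnSn.
    by rewrite ltnS [nat_of_ord j <= k]leq_eqVlt -[nat_of_ord j == k]/(j == i) (negbTE nji).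
  exact: reduces_app1.
have <- : mix (arity f) = ts by apply: funext => i; rewrite /mix ltn_ord.
exact: mixE.
Qed.

(** The shape of an identity or lift inference, with [G] in place of the premises. *)
Definition argwise (G : term F X -> term F X -> Prop) u t :=
  u = t \/ exists (f : F) (us ts : 'I_(arity f) -> term F X),
    [/\ u = app us, t = app ts & forall i, G (us i) (ts i)].

(* A coinduction principle: the pending [G]-obligations are pushed one level
   deeper at each stage, and the stages are concatenated. *)
Lemma reduces_coind (G : term F X -> term F X -> Prop) :
  (forall s t, G s t -> exists2 u, reduces 0 s u & argwise G u t) ->
  forall s t, G s t -> reduces 0 s t.
Proof.
move=> HG s0 t Gst.
(* Under [D n] all remaining [G]-obligations lie at depth [n]. *)
pose D n := iter n argwise G.
have D_agree n u v : D n u v -> agree n u v.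
  elim: n u v => [//|n IHn] u v /= [->//|[f [us [ts [-> -> Dut]]]]].
  by apply: agree_app => i; apply: IHn.
(* Working off the obligations at depth [n] takes a reduction of depth at least [n] and leaves
   obligations one level deeper. *)
have D_next n u v : D n u v -> exists2 u', reduces n u u' & D n.+1 u' v.
  elim: n u v => [//|n IHn] u v.
  move=> [->|[f [us [ts [-> -> Dut]]]]].
    by exists v; [apply: reduces_refl | left].
  have [us' us'P] := choice (fun i => let: ex_intro2 u r Du := IHn _ _ (Dut i) in
    ex_intro (fun u => reduces n (us i) u /\ D n.+1 u (ts i)) u (conj r Du)).
  exists (app us'); first by apply: reduces_app => i; case: (us'P i).
  by right; exists f, us', ts; split=> // i; case: (us'P i).
(* The stages are iterated by a total function; its value is junk where [D] fails. *)
have [next nextP] : {next : nat * term F X -> term F X & forall x, D x.1 x.2 t ->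
    reduces x.1 x.2 (next x) /\ D x.1.+1 (next x) t}.
  apply: (@choice _ _ (fun x y => D x.1 x.2 t -> reduces x.1 x.2 y /\ D x.1.+1 y t)).
  move=> [n u]; have [/D_next[u' ? ?]|nD] := pselect (D n u t); last by exists u.
  by exists u'.
pose fix ss n := if n is n'.+1 then next (n', ss n') else s0.
have Dss n : D n (ss n) t.
  by elim: n => // n /(nextP (n, ss n))[].
apply: (@reduces_omega 0 id ss) => // [n|k].
  by case: (nextP (n, ss n) (Dss n)).
by exists k => n kn; split=> //; apply: agreeW kn (D_agree _ _ _ (Dss n)).
Qed.

End Reductions.

(** * From proof trees to rewrite sequences *)

Section Convergence.
Variables (R : realType) (F : signature) (X : Type).
Implicit Types (s t u : term F X).

Lemma dist_agree n s t : (dist R s t < 2%:R ^- n)%R -> agree n s t.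
Proof.
rewrite /dist; case: pselect => [->//|neq]; case: ex_minnP => m _ minm.
rewrite ltf_pV2 ?posrE ?exprn_gt0 ?ltr0n // ltr_eXn2l ?ltr1n // => nm p pn.
apply: contrapT => np; have : m <= size p by apply: minm; apply/asboolP; exists p.
by rewrite leqNgt (ltn_trans pn nm).
Qed.

Lemma agree_dist n s t : agree n s t -> (`|dist R s t| <= 2%:R ^- n)%R.
Proof.
rewrite /dist => st; case: pselect => [_|neq].
  by rewrite normr0 invr_ge0 exprn_ge0 ?ler0n.
case: ex_minnP => m /asboolP[p pm np] _.
rewrite ger0_norm ?invr_ge0 ?exprn_ge0 ?ler0n //.
rewrite lef_pV2 ?posrE ?exprn_gt0 ?ltr0n // ler_eXn2l ?ltr1n //.
by rewrite leqNgt -pm; apply/negP => /st.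
Qed.

(** Balls of radius 2^-n form a neighbourhood basis at 0, so both filter limits become one statement
    about depths [n]. *)
Lemma converges_atP (W : woset) (ts : wosucc W -> term F X) (ps : W -> seq nat) l :
  converges_at R ts ps l <->
  forall n, exists2 b : W, wolt (Some b : wosucc W) l &
    forall c, wole b c -> wolt (Some c : wosucc W) l ->
      agree n (ts (Some c)) (ts l) /\ n <= size (ps c).
Proof.
split=> [[cd cp] n|H].
  have [|b1 /= b1l H1] := cd [set x | (`|x| < 2%:R ^- n)%R]%classic.
    apply/nbhs_ballP; exists (2%:R ^- n)%R => /=.
      by rewrite invr_gt0 exprn_gt0 ?ltr0n.
    by move=> x; rewrite /ball /= sub0r normrN.
  have [|b2 /= b2l H2] := cp [set m | n <= m]%classic.
    by exists n.
  have [b [b1b b2b bE]] := wo_max b1 b2; exists b; first by case: bE => ->.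
  move=> c bc cl; split.
    apply: dist_agree; apply: le_lt_trans (ler_norm _) _.
    by apply: (H1 c); split=> //; apply: wole_trans bc.
  by apply: (H2 c); split=> //; apply: wole_trans bc.
split=> A.
  move=> /nbhs_ballP[e /= e0 eA].
  have [n ne] : exists n, (2%:R ^- n < e)%R.
    (* Any natural bound of 1/e serves as [n], because n < 2^n. *)
    exists (Num.bound (e^-1))%R; rewrite invf_plt ?posrE ?exprn_gt0 ?ltr0n //.
    apply: lt_trans (archi_boundP _) _; first by rewrite invr_ge0 ltW.
    by rewrite -natrX ltr_nat ltn_expl.
  have [b bl Hb] := H n; exists b => // c [bc cl]; apply: eA.
  rewrite /ball /= sub0r normrN; apply: le_lt_trans ne; apply: agree_dist.
  by case: (Hb c).
move=> [N _ NA]; have [b bl Hb] := H N; exists b => // c [bc cl].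
by apply: NA; case: (Hb c).
Qed.

End Convergence.

(** * Back to sequences indexed by the steps that leave a term *)

Section FromReduction.
Variables (R : realType) (F : signature) (X : Type) (RS : trs F X).
Variables (s t : term F X) (r : reduction RS 0 s t).

(** Keeping only the points reached by a genuine step removes limits and idle moves; the order type
    left is the length of the sequence. *)
Definition steps : woset := wosub (fun a : pts r => isSome (pos a)).

Lemma steps_pred (w : steps) : exists2 b, is_succ b (sval w) &
  exists2 p, pos (sval w) = Some p & step RS p (at_ b) (at_ (sval w)).
Proof.
case: w => a /= Sa; have na : a <> bot r by move=> ab; rewrite ab pos_bot in Sa.
by have := pos_arrival na; rewrite /arrival; case: (pos a) Sa => // p _ [b];
  exists b => //; exists p.
Qed.

Lemma reduction_ord : rewrites_ord RS R s t.
Proof.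
have [pr prP] := choice (fun w => let: ex_intro2 b bw H := steps_pred w in
  ex_intro (fun b => is_succ b (sval w) /\ exists2 p, pos (sval w) = Some p &
     step RS p (at_ b) (at_ (sval w))) b (conj bw H)).
(* The term at ordinal [c] has to be the source of step [c], hence the predecessor of its arrival
   point. *)
pose y (c : wosucc steps) : pts r := if c is Some w then pr w else top r.
have lt_y (w : steps) c : wolt (Some w : wosucc steps) c = wole (sval w) (y c).
  case: c => [v|]; last by rewrite top_ge.
  have [[prv minv] _] := prP v; rewrite wosucc_ltE /=.
  apply/idP/idP => [wv|]; first exact: (is_succ_lt (conj prv minv)).
  by move=> /wole_lt_trans/(_ prv).
(* If [z] bounds all steps before [c], only idle moves and limits lie between [z] and [y c]. *)
have nstep z c : (forall w : steps, wolt (Some w : wosucc steps) c -> wole (sval w) z) ->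
    wole z (y c) -> at_ z = at_ (y c).
  move=> H zc; apply: reduction_idle => // x zx xc.
  case E: (pos x) => [p|//]; have Sx : isSome (pos x) by rewrite E.
  have := H (exist _ x Sx); rewrite lt_y => /(_ xc) /=.
  by rewrite woleNgt zx.
pose ps (w : steps) := odflt [::] (pos (sval w)).
pose ts (c : wosucc steps) := at_ (y c).
have conv l : is_limit l -> converges_at R ts ps l.
  move=> [nz nsucc]; apply/converges_atP => n.
  (* [m] is the supremum of the steps before [l]. There is no last such step, so [m] is not reached
     by a step and convergence at [m] applies. *)
  have [|m mub minm] := @wo_min (pts r)
      (fun x => forall w : steps, wolt (Some w : wosucc steps) l -> wole (sval w) x).
    by exists (y l) => w; rewrite lt_y.
  have ml : wole m (y l) by apply: minm => w; rewrite lt_y.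
  have tsl : ts l = at_ m by rewrite (nstep _ _ mub ml).
  have ltl (w : steps) : wolt (Some w : wosucc steps) l ->
      exists2 v : steps, wolt w v & wolt (Some v : wosucc steps) l.
    move=> wl; apply: contrapT => nv; apply: nsucc; exists (Some w); split=> //.
    move=> c wc; rewrite woleNgt; apply/negP => cl; apply: nv.
    by case: c wc cl => [v wv vl|_]; [exists v | rewrite woltNge wosucc_top].
  have posm : pos m = None.
    case E: (pos m) => [p|//]; have Sm : isSome (pos m) by rewrite E.
    have [|v mv vl] := ltl (exist _ m Sm); first by rewrite lt_y.
    by have := mub v vl; rewrite woleNgt (mv : wolt m (sval v)).
  have nm : m <> bot r.
    move=> mb; apply: nz => c; rewrite woleNgt; apply/negP.
    case: c => [w wl|]; last by rewrite woltNge wosucc_top.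
    case: (prP w) => -[bw _] _.
    have := mub w wl; rewrite mb woleNgt; apply/negP/negPn.
    exact: wole_lt_trans (bot_le _) bw.
  move: (pos_arrival nm); rewrite /arrival posm => /(_ n)[b bm Hb].
  have [w wl bw] : exists2 w : steps, wolt (Some w : wosucc steps) l & wolt b (sval w).
    apply: contrapT => nw; have : wole m b.
      apply: minm => w wl; rewrite woleNgt; apply/negP => bw; apply: nw.
      by exists w.
    by rewrite woleNgt bm.
  (* Starting one step after [w] ensures that the source of each later step, and not only its
     target, lies beyond [b]. *)
  have [v wv vl] := ltl w wl; exists v => // c vc cl.
  have wc : wolt w c := wolt_le_trans wv vc.
  have [u cu ul] := ltl c cl.
  have cm : wolt (sval c) m.
    by apply: (@wolt_le_trans _ _ (sval u)) => //; apply: mub.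
  have [[prc minc] [p posc stc]] := prP c.
  have wpc : wole (sval w) (pr c) by rewrite -(lt_y w (Some c)).
  have bpc : wolt b (pr c) := wolt_le_trans bw wpc.
  split.
    rewrite tsl; case: (Hb (pr c)) => //; first exact: woltW.
    exact: wolt_le_trans prc (woltW cm).
  have bc : wolt b (sval c) := wolt_le_trans bpc (woltW prc).
  rewrite /ps posc; case: (Hb (sval c)) => //; first exact: woltW.
  by move=> _ /(_ bc p posc).
exists steps, ts, ps; split.
- split=> [w c [wc minc]|l]; last exact: conv.
  have [[prw _] [p posw stw]] := prP w.
  rewrite /ps posw /ts /=; rewrite -(nstep (sval w) c) //; last by rewrite -lt_y.
  move=> v vc; rewrite woleNgt; apply/negP => wv.
  by have := minc (Some v) wv; rewrite woleNgt vc.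
- by right.
- have [|z _ minz] := @wo_min (wosucc steps) (fun=> True); first by exists None.
  exists z; first by move=> c; apply: minz.
  rewrite /ts -(nstep (bot r)) ?at_bot ?bot_le // => w wz.
  by have := minz (Some w) I; rewrite woleNgt wz.
- exact: at_top.
Qed.

End FromReduction.

(** * Realising the nodes of a proof tree by reductions *)

Section FromTree.
Variables (F : signature) (X : Type) (RS : trs F X).
Implicit Types (s t u : term F X) (T N M : tree F X).

Fixpoint reach (k : nat) N M : Prop :=
  if k is k'.+1 then exists i : 'I_(nprems N), reach k' (prem i) M else M = N.

Lemma reach_trans k l N M M' : reach k N M -> reach l M M' -> reach (k + l) N M'.
Proof.
elim: k N => [|k IHk] N /= => [-> //|[i NM] MM']; exists i; exact: IHk.
Qed.

Lemma reach_node T k N M : node_of T N -> reach k N M -> node_of T M.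
Proof.
elim: k N => [|k IHk] N TN /= => [->//|[i]]; apply: IHk; exact: node_prem.
Qed.

Definition marked_above M N := exists2 k, reach k.+1 N M & is_DownLt (concl M).

(** Otherwise dependent choice yields a path through infinitely many marked nodes. *)
Lemma marked_above_acc T : ~ infinitely_nested T -> Acc marked_above T.
Proof.
move=> nonest; apply: contrapT => naccT.
(* [k] counts the levels from [N] up to an inaccessible marked node. *)
pose bad k N := exists M, [/\ reach k N M, is_DownLt (concl M) & ~ Acc marked_above M].
have nacc_bad N : ~ Acc marked_above N -> exists k, bad k.+1 N.
  move=> nacc; apply: contrapT => nbad; apply: nacc; constructor => M [k NM dM].
  by apply: contrapT => naccM; apply: nbad; exists k, M.
(* The counter falls by one per level; at 0 the marked node is reached, and its inaccessibility
   supplies a new target. *)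
have next (x : nat * tree F X) : exists y : nat * tree F X, bad x.1 x.2 ->
    [/\ bad y.1 y.2, exists i, y.2 = @prem _ _ x.2 i &
       if x.1 is k.+1 then y.1 = k else is_DownLt (concl x.2)].
  case: x => k N; have [b|nb] := pselect (bad k N); last by exists (k, N).
  have [l [bl lk]] : exists l, bad l.+1 N /\
      if k is k'.+1 then l = k' else is_DownLt (concl N).
    case: k b => [[M [/= -> dN naccN]]|k b]; last by exists k.
    by have [l bl] := nacc_bad _ naccN; exists l.
  have [M [[i iM] dM naccM]] := bl.
  exists (l, prem i) => _; split=> //=; last by exists i.
  by exists M.
have [f fP] := choice next.
have [k0 bk0] := nacc_bad T naccT.
pose g n := iter n f (k0.+1, T).
have gbad n : bad (g n).1 (g n).2.
  by elim: n => [//|n IHn]; rewrite /g iterS; case: (fP _ IHn).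
apply: nonest; exists (fun n => (g n).2).
  by split=> // n; rewrite /g iterS; case: (fP _ (gbad n)).
(* Induction on the counter at [m]: when it has run down, the path stands at a marked node. *)
move=> m; elim: {m}(g m).1 {-2}m (erefl (g m).1) => [|k IHk] m gm.
  by exists m => //; case: (fP _ (gbad m)); rewrite gm.
have [|n mn dn] := IHk m.+1; last by exists n => //; apply: ltnW.
by rewrite /g iterS; case: (fP _ (gbad m)); rewrite gm.
Qed.

Variable T : tree F X.
Hypothesis PT : proof_tree RS T.

Lemma prem_in N j : List.In j [seq concl (prem i) | i <- enum 'I_(nprems N)] ->
  exists i : 'I_(nprems N), concl (prem i) = j.
Proof. by elim: (enum _) => //= i e IHe [<-|/IHe //]; exists i. Qed.

Lemma split_prefix_reduces s js u : split_prefix s js u ->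
  (forall v w, List.In (Root v w) js -> step RS [::] v w) ->
  (forall v w, List.In (DownLt v w) js -> reduces RS 0 v w) ->
  reduces RS 0 s u.
Proof.
elim=> {s js u} [s _ _|s v u js _ IH Hr Hd|s v u js _ IH Hr Hd].
- exact: reduces_refl.
- apply: (@reduces_trans _ _ _ _ _ v).
    by apply: (@reduces_step _ _ _ _ [::]) => //; apply: Hr; left.
  by apply: IH => a b H; [apply: Hr | apply: Hd]; right.
- apply: (@reduces_trans _ _ _ _ _ v); first by apply: Hd; left.
  by apply: IH => a b H; [apply: Hr | apply: Hd]; right.
Qed.

Lemma in_lift_premises (f : F) (ss ts : 'I_(arity f) -> term F X) i :
  List.In (Many (ss i) (ts i)) (lift_premises ss ts).
Proof.
rewrite /lift_premises; have : i \in enum 'I_(arity f) by rewrite mem_enum.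
by elim: (enum _) => //= j e IHe; rewrite inE => /orP[/eqP ->|/IHe]; [left | right].
Qed.

Lemma node_many_inv N s t : node_of T N -> concl N = Many s t ->
  exists js u, [/\ split_prefix s js u,
    forall j, List.In j js -> exists i : 'I_(nprems N), concl (prem i) = j
    & exists i : 'I_(nprems N), concl (prem i) = Down u t].
Proof.
move=> TN; have := PT TN; move=> /[swap] -> ru.
inversion ru as [|s' js' u t' sp e1 e2| | | |]; subst.
exists js', u; split=> // [j jin|]; apply: prem_in; rewrite -e1.
  by rewrite -cats1; apply/In_cat; left.
by rewrite -cats1; apply/In_cat; right; left.
Qed.

Lemma node_root_inv N s t : node_of T N -> concl N = Root s t -> step RS [::] s t.
Proof.
by move=> TN cN; have := PT TN; rewrite cN => ru; inversion ru.
Qed.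

Lemma node_lift_inv N s t : node_of T N -> concl N = Down s t \/ concl N = DownLt s t ->
  argwise (fun s t => exists i : 'I_(nprems N), concl (prem i) = Many s t) s t.
Proof.
move=> TN cN; have ru := PT TN.
case: cN => cN; rewrite {}cN in ru; inversion ru as [| |f ss ts e|f ss ts e| |];
  subst; try by left.
all: right; do 3 eexists; split; [reflexivity|reflexivity|move=> i].
all: by apply: prem_in; rewrite -e; apply: in_lift_premises.
Qed.

(** Well-founded induction on the marked nodes above [N]. It makes the prefixes of all splits at or
    above [N] available, and [reduces_coind] then joins them. *)
Lemma node_reduces N : Acc marked_above N -> node_of T N ->
  (forall s t, concl N = Many s t -> reduces RS 0 s t) /\
  (forall s t, concl N = DownLt s t -> reduces RS 0 s t).
Proof.
elim=> {}N _ IH TN.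
(* The obligations are the conclusions of all [Many] nodes at or above [N]. *)
pose G s t := exists k M, reach k N M /\ concl M = Many s t.
have Gred s t : G s t -> reduces RS 0 s t.
  apply: reduces_coind => {}s {}t [k [M [NM cM]]].
  have TM := reach_node TN NM.
  have [js [u [sp jsP [i ci]]]] := node_many_inv TM cM.
  have NMi (j : 'I_(nprems M)) : reach k.+1 N (prem j).
    by rewrite -addn1; apply: reach_trans NM _; exists j.
  exists u.
    apply: split_prefix_reduces sp _ _ => v w /jsP[j cj].
      by apply: node_root_inv cj; apply: node_prem.
    (* A marked premise of [M] lies at least one level above [N], so the induction hypothesis covers
       it. *)
    have [||_ /(_ _ _ cj)//] := IH (prem j); last exact: node_prem.
    by exists k; rewrite ?cj.
  have [->|[f [us [ts [-> -> H]]]]] := node_lift_inv (node_prem i TM) (or_introl ci).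
    by left.
  right; exists f, us, ts; split=> // a; have [b cb] := H a.
  exists k.+2, (prem b); split=> //; rewrite -addn1.
  by apply: reach_trans (NMi i) _; exists b.
split=> s t cN; first by apply: Gred; exists 0, N.
have [->|[f [us [ts [-> -> H]]]]] := node_lift_inv TN (or_intror cN).
  exact: reduces_refl.
apply: (reducesW (leq0n 1)); apply: reduces_app => a; apply: Gred.
by have [b cb] := H a; exists 1, (prem b); split=> //; exists b.
Qed.

End FromTree.

(** * From rewrite sequences to proof trees *)

Section RankedTree.
Variables (F : signature) (X : Type) (RS : trs F X) (V : woset).
Variable Q : V -> judgement F X -> Prop.

Variable kids : V * judgement F X -> seq (V * judgement F X).

CoFixpoint unfold_tree (x : V * judgement F X) : tree F X :=
  Node x.2 (fun i : 'I_(size (kids x)) => unfold_tree (tnth (in_tuple (kids x)) i)).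

Hypothesis kids_rule : forall x, Q x.1 x.2 -> rule RS (map snd (kids x)) x.2.
Hypothesis kidsP : forall x k, Q x.1 x.2 -> List.In k (kids x) ->
  [/\ Q k.1 k.2, wole k.1 x.1 & is_DownLt k.2 -> wolt k.1 x.1].

Lemma unfold_node x N : Q x.1 x.2 -> node_of (unfold_tree x) N ->
  exists2 y, Q y.1 y.2 & N = unfold_tree y.
Proof.
move=> Qx; elim=> [|{}N i _ [y Qy EN]]; first by exists x.
subst N; exists (tnth (in_tuple (kids y)) i) => //.
by case: (kidsP Qy (In_tnth i)).
Qed.

Lemma unfold_proof x : Q x.1 x.2 -> proof_tree RS (unfold_tree x).
Proof.
move=> Qx N /(unfold_node Qx)[y Qy ->].
have -> : [seq concl (prem i) | i <- enum 'I_(nprems (unfold_tree y))] =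
    [seq k.2 | k <- [seq tnth (in_tuple (kids y)) i | i <- enum 'I_(size (kids y))]].
  by rewrite -map_comp.
by rewrite map_tnth_enum; apply: kids_rule.
Qed.

(** Induction on the rank of the root: from a marked node on, the rest of the path is again
    infinitely nested, but starts at a smaller rank. *)
Lemma unfold_not_nested x : Q x.1 x.2 -> ~ infinitely_nested (unfold_tree x).
Proof.
move: {-1}x.1 (erefl x.1) => v; elim/wo_ind: v x => v IH x xv Qx [f [f0 fS] dense].
have fP n : exists y, [/\ Q y.1 y.2, f n = unfold_tree y, wole y.1 v &
    forall m, m < n -> is_DownLt (concl (f m.+1)) -> wolt y.1 v].
  elim: n => [|n [y [Qy fn yv yd]]]; first by exists x; split; rewrite ?xv ?wole_refl.
  case: (fS n); rewrite fn => i fSn.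
  have [Qk ky kd] := kidsP Qy (In_tnth i).
  exists (tnth (in_tuple (kids y)) i); split=> //; first exact: wole_trans yv.
  move=> m; rewrite ltnS leq_eqVlt => /orP[/eqP ->|mn dm].
    by rewrite fSn => dk; apply: wolt_le_trans yv; apply: kd.
  by apply: wole_lt_trans ky _; apply: yd dm.
(* The index is at least 1, since the rank drops on entering a marked node and a marked root is
   never entered. *)
have [[//|n] _ dn] := dense 1.
have [y [Qy fn _ /(_ n (leqnn _) dn) yv]] := fP n.+1.
apply: (IH y.1 yv y) => //; exists (fun m => f (n.+1 + m)).
  by split=> [|m]; rewrite ?addn0 // addnS.
move=> m; have [k mk dk] := dense (n.+1 + m); exists (k - n.+1).
  by rewrite leq_subRL // (leq_trans _ mk) // leq_addr.
by rewrite subnKC // (leq_trans _ mk) // leq_addr.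
Qed.

End RankedTree.

(** Ranks replace the nesting condition: a well-founded rank that never rises can drop at only
    finitely many marked nodes. *)
Lemma ranked_coind (F : signature) (X : Type) (RS : trs F X) (V : woset)
    (Q : V -> judgement F X -> Prop) :
  (forall v j, Q v j -> exists ks : seq (V * judgement F X),
     rule RS (map snd ks) j /\ forall k, List.In k ks ->
       [/\ Q k.1 k.2, wole k.1 v & is_DownLt k.2 -> wolt k.1 v]) ->
  forall v s t, Q v (Many s t) -> rewrites_coind RS s t.
Proof.
move=> H v s t Qst.
have [kids kidsP] : {kids : V * judgement F X -> seq (V * judgement F X) & forall x,
    Q x.1 x.2 -> rule RS (map snd (kids x)) x.2 /\ forall k, List.In k (kids x) ->
       [/\ Q k.1 k.2, wole k.1 x.1 & is_DownLt k.2 -> wolt k.1 x.1]}.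
  apply: (@choice _ _ (fun x ks => Q x.1 x.2 -> rule RS (map snd ks) x.2 /\
    forall k, List.In k ks ->
       [/\ Q k.1 k.2, wole k.1 x.1 & is_DownLt k.2 -> wolt k.1 x.1])) => x.
  by have [/H[ks]|nQ] := pselect (Q x.1 x.2); [exists ks | exists [::]].
have kr x (Qx : Q x.1 x.2) := (kidsP x Qx).1.
have kp x k (Qx : Q x.1 x.2) := (kidsP x Qx).2 k.
exists (unfold_tree kids (v, Many s t)); split=> //.
  exact: (unfold_proof kr kp).
exact: (unfold_not_nested kp).
Qed.

(** * Intervals of a transfinite rewrite sequence *)

Section FromOrd.
Variables (F : signature) (X : Type) (RS : trs F X) (W : woset).
Variables (ts : wosucc W -> term F X) (ps : W -> seq nat).
Implicit Types (a b v : wosucc W) (c : W) (p q : seq nat).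

Hypothesis ts_step : forall c b,
  is_succ (Some c : wosucc W) b -> step RS (ps c) (ts (Some c)) (ts b).
Hypothesis ts_limit : forall b, is_limit b -> forall n,
  exists2 c, wolt (Some c : wosucc W) b &
    forall d, wole c d -> wolt (Some d : wosucc W) b ->
      agree n (ts (Some d)) (ts b) /\ n <= size (ps d).

(** Serves inductions on the right end [b] of an interval; the witness at a limit is moved up to [a]
    or beyond. *)
Lemma ord_cases a b : wole a b -> [\/ a = b,
  exists c, [/\ is_succ (Some c : wosucc W) b, wole a (Some c) & wolt (Some c : wosucc W) b] |
  forall n, exists c, [/\ wole a (Some c), wolt (Some c : wosucc W) b &
    forall d, wole c d -> wolt (Some d : wosucc W) b ->
      agree n (ts (Some d)) (ts b) /\ n <= size (ps d)]].
Proof.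
move=> ab; have [->|lt_ab] := wole_eqVlt ab; first by constructor 1.
case: (wo_cases b) => [zb|[[c|] cb]|lb].
- by move: lt_ab; rewrite woltNge zb.
- by constructor 2; exists c; split=> //; [apply: is_succ_lt lt_ab | case: cb].
- by case: cb; rewrite woltNge wosucc_top.
- constructor 3 => n; have [c cb Hc] := ts_limit lb n.
  case: a {ab} lt_ab => [a|] ab; last by move: ab; rewrite woltNge wosucc_top.
  have [d [cd ad dE]] := wo_max c a; exists d; split=> //.
    by case: dE => ->.
  by move=> e de; apply: Hc; apply: wole_trans de.
Qed.

(** The invariant of half-arrow nodes. That of [Many] nodes, [quiet_above], still allows steps at
    [p] itself. *)
Definition quiet a b p :=
  forall c, wole a (Some c) -> wolt (Some c : wosucc W) b -> ~~ prefix (ps c) p.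

Definition quiet_above a b p :=
  forall c, wole a (Some c) -> wolt (Some c : wosucc W) b -> prefix (ps c) p -> ps c = p.

Lemma quiet_aboveW a b a' b' p :
  quiet_above a b p -> wole a a' -> wole b' b -> quiet_above a' b' p.
Proof.
move=> q aa' bb' c ac cb; apply: q; first exact: wole_trans ac.
exact: wolt_le_trans bb'.
Qed.

(** Induction on [b]; at a limit, precision [(size p).+1] is the first that sees the label at
    [p]. *)
Lemma quiet_label a b p : wole a b -> quiet a b p -> ts a p = ts b p.
Proof.
elim/wo_ind: b => b IH ab q.
case: (ord_cases ab) => [->//|[c [cb ac lt_cb]]|/(_ (size p).+1)[c [ac cb H]]].
  rewrite (IH _ lt_cb ac) => [|d ad dc].
    by apply: (step_out (ts_step cb)); apply: q.
  by apply: q => //; apply: wolt_le_trans (woltW lt_cb).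
rewrite (IH _ cb ac) => [|d ad dc].
  by case: (H c (wole_refl c) cb) => + _; apply.
by apply: q => //; apply: wolt_le_trans (woltW cb).
Qed.

(** Whether a child of a node exists depends only on the label of that node, which changes only by
    steps strictly above the child. *)
Lemma quiet_position a b p : wole a b -> quiet_above a b p ->
  ts a p <> None -> ts b p <> None.
Proof.
move=> ab; case/lastP: p => [_ _|p i q]; first by case: (labelP (ts b)).
suff E : ts a p = ts b p.
  by move/(labelP (ts a)).2 => H; apply/(labelP (ts b)).2; rewrite -E.
apply: quiet_label => // c ac cb; apply/negP => cp.
have := q c ac cb (prefix_trans cp (prefix_rcons p i)).
by move=> E; have := size_prefix cp; rewrite E size_rcons ltnn.
Qed.

Lemma quiet_child a b p i : quiet a b p -> quiet_above a b (rcons p i).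
Proof.
move=> q c ac cb /prefixP[s]; case/lastP: s => [|s j]; first by rewrite cats0.
rewrite -rcons_cat => /rcons_inj[pE _]; have := q c ac cb.
by rewrite pE prefix_prefix.
Qed.

(** The rank [v] is the right end of the interval; the left end [a] stays existential, as it may
    grow along a path. *)
Definition derivable v (j : judgement F X) : Prop :=
  match j with
  | Root s t => step RS [::] s t
  | Many s t => exists a p, [/\ wole a v, ts a p <> None, quiet_above a v p,
      s = subterm (ts a) p & t = subterm (ts v) p]
  | Down s t | DownLt s t => exists a p, [/\ wole a v, ts a p <> None, quiet a v p,
      s = subterm (ts a) p & t = subterm (ts v) p]
  end.

Lemma split_prefix_cat s js t js' u :
  split_prefix s js t -> split_prefix t js' u ->
  split_prefix (F := F) (X := X) s (js ++ js') u.
Proof.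
elim=> // {s js t} s v t js _ IH tu.
  by apply: split_root; apply: IH.
by apply: split_down; apply: IH.
Qed.

(* The steps at [p] between [a] and [b] are finitely many: at a limit, the depths
   of the last steps exceed the depth of [p]. *)
Lemma root_steps a b p : wole a b -> ts a p <> None -> quiet_above a b p ->
  exists (c : wosucc W) (ks : seq (wosucc W * judgement F X)), [/\ wole a c, wole c b, quiet c b p,
    split_prefix (subterm (ts a) p) (map snd ks) (subterm (ts c) p) &
    forall k, List.In k ks -> derivable k.1 k.2 /\ wolt k.1 b].
Proof.
elim/wo_ind: b => b IH ab ap qab.
case: (ord_cases ab) => [ba|[c [cb ac lt_cb]]|/(_ (size p).+1)[c [ac cb H]]].
- exists a, [::]; split; rewrite ?ba ?wole_refl //; last exact: split_nil.
  by move=> c bc; rewrite woltNge bc.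
- have [d [ks [ad dc qd sp ksP]]] :=
    IH _ lt_cb ac ap (quiet_aboveW qab (wole_refl a) (woltW lt_cb)).
  have [cp|ncp] := pselect (ps c = p); last first.
    exists d, ks; split=> //; first exact: wole_trans (woltW lt_cb).
      move=> e de eb; have [ec|ec] := wole_eqVlt (is_succ_lt cb eb); last exact: qd.
      by case: ec => ->; apply/negP => /(qab c ac lt_cb).
    by move=> k /ksP[Dk kc]; split=> //; apply: wolt_le_trans (woltW lt_cb).
  (* A step at [p] closes a segment: the stretch from [d] to [c] becomes a marked premise, the step
     itself a root step, both of rank below [b]. *)
  exists b, (ks ++ [:: (Some c, DownLt (subterm (ts d) p) (subterm (ts (Some c)) p));
                   (Some c, Root (subterm (ts (Some c)) p) (subterm (ts b) p))]).
  split; rewrite ?wole_refl //.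
  + by move=> e be; rewrite woltNge be.
  + rewrite map_cat; apply: split_prefix_cat sp _ => /=.
    by apply: split_down; apply: split_root; apply: split_nil.
  + move=> k /In_cat[/ksP[Dk kc]|].
      by split=> //; apply: wolt_le_trans (woltW lt_cb).
    case=> [<-|[<-|//]]; split=> //=; last by rewrite -cp; apply: step_subterm; apply: ts_step.
    exists d, p; split=> //; apply: quiet_position ap => //.
    by apply: quiet_aboveW qab _ _; rewrite ?wole_refl //; apply: wole_trans (woltW lt_cb).
- have [d [ks [ad dc qd sp ksP]]] :=
    IH _ cb ac ap (quiet_aboveW qab (wole_refl a) (woltW cb)).
  exists d, ks; split=> //; first exact: wole_trans (woltW cb).
    move=> e de eb; have [ec|] := boolP (wolt (Some e : wosucc W) (Some c)).
      exact: qd.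
    rewrite -woleNgt => ce; case: (H e ce eb) => _ pe; apply/negP => /size_prefix.
    by rewrite leqNgt pe.
  by move=> k /ksP[Dk kc]; split=> //; apply: wolt_le_trans (woltW cb).
Qed.

(** The head symbol at [p] never changes, so all activity below [p] takes place in the arguments; a
    variable head leaves nothing to rewrite. *)
Lemma subterm_lift a v p : wole a v -> ts a p <> None -> quiet a v p ->
  subterm (ts a) p = subterm (ts v) p \/
  exists (f : F) (us us' : 'I_(arity f) -> term F X),
    [/\ subterm (ts a) p = app us, subterm (ts v) p = app us' &
        forall i, derivable v (Many (us i) (us' i))].
Proof.
move=> av ap q; have E := quiet_label av q.
have vp : ts v p <> None by rewrite -E.
have ha : subterm (ts a) p [::] = ts a p by rewrite subtermE // cats0.
have hv : subterm (ts v) p [::] = ts a p by rewrite subtermE // cats0.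
case Ep: (ts a p) ha hv => [[f|x]|] // ha hv; last first.
  by left; rewrite (head_var ha) (head_var hv).
right; have [ca ea] := head_app ha; have [cv ev] := head_app hv.
do 3 eexists; split; [exact: ea|exact: ev|move=> i /=].
have pa : ts a (rcons p i.+1) <> None.
  by have := ca i; rewrite subtermE // cats1.
exists a, (rcons p i.+1); split=> //; first exact: quiet_child.
  by rewrite subterm_cat cats1.
by rewrite subterm_cat cats1 //; apply: quiet_position pa => //; apply: quiet_child.
Qed.

Lemma ord_coind z : is_zero z -> rewrites_coind RS (ts z) (ts None).
Proof.
(* The root node covers the whole sequence at the empty position, strictly above which there is
   nothing. *)
move=> z0; apply: (ranked_coind (Q := derivable) _ (v := None)); last first.
  exists z, [::]; rewrite !subterm_nil; split=> //; first by case: (labelP (ts z)).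
  by move=> c _ _; case: (ps c).
(* Marked and unmarked half arrows unfold alike, into [Many] premises of unchanged rank. *)
have lift v j s t : j = Down s t \/ j = DownLt s t -> derivable v j ->
    exists ks : seq (wosucc W * judgement F X), rule RS (map snd ks) j /\
      forall k, List.In k ks ->
        [/\ derivable k.1 k.2, wole k.1 v & is_DownLt k.2 -> wolt k.1 v].
  move=> jE Dj; have [a [p [av ap q se te]]] : exists a p, [/\ wole a v,
      ts a p <> None, quiet a v p, s = subterm (ts a) p & t = subterm (ts v) p].
    by case: jE Dj => ->.
  subst s t.
  case: (subterm_lift av ap q) => [E|[f [us [us' [ea ev D]]]]].
    exists [::]; split=> //; rewrite E in jE.
    by case: jE => ->; [apply: rule_id | apply: rule_id_lt].
  exists [seq (v, Many (us i) (us' i)) | i <- enum 'I_(arity f)]; split.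
    rewrite -map_comp; rewrite ea ev in jE.
    by case: jE => ->; [apply: rule_lift | apply: rule_lift_lt].
  move=> k kin; have [i ->] := In_map kin; split=> //; [exact: D | exact: wole_refl].
move=> v [s t|s t|s t|s t] D.
- by exists [::]; split=> //; apply: rule_root.
- have [a [p [av ap q -> ->]]] := D.
  have [c [ks [ac cv qc sp ksP]]] := root_steps av ap q.
  exists (rcons ks (v, Down (subterm (ts c) p) (subterm (ts v) p))); split.
    by rewrite map_rcons; apply: rule_split.
  move=> k; rewrite -cats1 => /In_cat[/ksP[Dk kv]|[<-|//]].
    by split=> //; apply: woltW.
  split=> //; last exact: wole_refl.
  exists c, p; split=> //; apply: quiet_position ap => //.
  by apply: quiet_aboveW q _ _; rewrite ?wole_refl.
- exact: (lift v _ s t (or_introl erefl) D).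
- exact: (lift v _ s t (or_intror erefl) D).
Qed.

End FromOrd.

Theorem theorem2 (R : realType) (F : signature) (X : Type)
    (X_infinite : infinite_set [set: X]%classic) (RS : trs F X)
    (s t : term F X) :
  rewrites_coind RS s t <-> rewrites_ord RS R s t.
Proof.
split=> [[T [cT PT nT]]|[W [ts [ps [[st lim] sc [z z0 <-] <-]]]]].
  have [/(_ _ _ cT)[r] _] := node_reduces PT (marked_above_acc nT) (node_root T).
  exact: reduction_ord r.
apply: (@ord_coind _ _ _ _ ts ps) => // b lb; apply/(converges_atP R).
(* For a successor length, the top is not a limit, and the limits below it converge by the
   definition of a rewrite sequence. *)
case: sc => [[c cN]|]; last exact.
case: b lb => [b|[_ []]]; first exact: lim.
by exists c.
Qed.
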